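(* Non-degenerate contractible spatiolateral de Sitter triangles do not satisfy the triangle inequality: if $\Delta\subset S^{1,1}$ is a non-degenerate contractible spatiolateral triangle, then its vertices can be named $A,B,C$ in such a way that the side lengths satisfy $b+c<a$, where $a$ is the length of the side between $B$ and $C$, $b$ of that between $A$ and $C$, and $c$ of that between $A$ and $B$.
   Context: On $\mathbb{R}^3$ let $\langle\langle x,y\rangle\rangle=-x_1y_1+x_2y_2+x_3y_3$. $S^{1,1}=\{x:\langle\langle x,x\rangle\rangle=1\}$. A two-dimensional linear subspace is spacelike if $\langle\langle\cdot,\cdot\rangle\rangle$ restricted to it is positive definite. For $A,B\in S^{1,1}$ with $A\ne\pm B$, the side between $A$ and $B$ is spacelike if $\operatorname{span}(A,B)$ is spacelike (equivalently $|\langle\langle A,B\rangle\rangle|<1$); its length is then $\arccos(\langle\langle A,B\rangle\rangle)\in(0,\pi)$. A spatiolateral triangle is a set of three distinct points $\{A,B,C\}\subset S^{1,1}$ all of whose sides are spacelike; it is non-degenerate if $A,B,C$ are linearly independent. It is contractible if, after projecting the vertices to the $(x_2,x_3)$-plane, there is a line through the origin such that all three projected points lie on one side of the line. *)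

(* Defs.v *)
From HB Require Import structures.
From mathcomp Require Import all_boot all_order all_algebra.
From mathcomp Require Import finmap.
From mathcomp Require Import reals trigo.

Set Implicit Arguments.
Unset Strict Implicit.
Unset Printing Implicit Defensive.

Import Order.TTheory GRing.Theory Num.Theory.

Local Open Scope ring_scope.

(* The coordinates x_1, x_2, x_3 are x 0 0, x 0 1, x 0 2. *)
Definition minkowski (R : realType) (x y : 'rV[R]_3) : R :=
  - (x 0 0 * y 0 0) + x 0 1 * y 0 1 + x 0 2 * y 0 2.

Definition deSitter (R : realType) (x : 'rV[R]_3) : Prop := minkowski x x = 1.

Definition spacelike (R : realType) (U : {vspace 'rV[R]_3}) : Prop :=
  \dim U = 2%N /\ (forall u, u \in U -> u != 0 -> 0 < minkowski u u).

Definition spacelike_side (R : realType) (A B : 'rV[R]_3) : Prop :=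
  [/\ A != B, A != - B & spacelike <<[:: A; B]>>%VS].

Definition side_length (R : realType) (A B : 'rV[R]_3) : R :=
  acos (minkowski A B).

Definition spatiolateral (R : realType) (D : {fset 'rV[R]_3}) : Prop :=
  [/\ #|` D|%fset = 3%N,
      forall A, A \in D -> deSitter A &
      forall A B, A \in D -> B \in D -> A != B -> spacelike_side A B].

Definition nondegenerate_triangle (R : realType) (D : {fset 'rV[R]_3}) : Prop :=
  free (D : seq 'rV[R]_3).

Definition proj23 (R : realType) (x : 'rV[R]_3) : 'rV[R]_2 :=
  \row_(j < 2) x 0 (lift ord0 j).

(* A line through the origin of the plane is the orthogonal complement of some
   n != 0, and its two (open) sides are {p | 0 < n . p} and {p | 0 < - n . p};
   trading n for - n exchanges them, so it suffices to consider the first.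
   Asking only 0 <= n . p would define the same notion for spatiolateral
   triangles: the projections are nonzero, and those of the endpoints of a
   spacelike side never point in opposite directions. *)
Definition contractible (R : realType) (D : {fset 'rV[R]_3}) : Prop :=
  exists2 n : 'rV[R]_2, n != 0 &
    forall A, A \in D -> 0 < \sum_(j < 2) n 0 j * proj23 A 0 j.

(* Main.v *)
(* Let G be the Gram matrix of the vertices A, B, C, with off-diagonal entries
   p = <<B,C>>, q = <<A,C>>, r = <<A,B>>.  Its determinant is - det(A,B,C)^2 < 0,
   that is, (p - q r)^2 > (1 - q^2) (1 - r^2), and likewise for q and r.
   Contractibility provides a spacelike N = (0, n) with positive products with
   A, B, C.  If q r - p, p r - q and p q - r were all positive, then all entries
   of G^-1 would be negative, and so would be <<N,N>>.  Hence, say, p >= q r, and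
   then p > q r + sin b sin c = cos (b - c), i.e. a < |b - c|, so that one of b, c
   exceeds the sum of the other two lengths. *)
Require Import Defs.
From HB Require Import structures.
From mathcomp Require Import all_boot all_order all_algebra.
From mathcomp Require Import finmap.
From mathcomp Require Import reals trigo.
From mathcomp Require Import ring lra.

Set Implicit Arguments.
Unset Strict Implicit.
Unset Printing Implicit Defensive.

Import Order.TTheory GRing.Theory Num.Theory.

Local Open Scope ring_scope.

Lemma minkowskiC (R : realType) (x y : 'rV[R]_3) :
  minkowski x y = minkowski y x.
Proof. by rewrite /minkowski; ring. Qed.

Lemma side_lengthC (R : realType) (A B : 'rV[R]_3) :
  side_length A B = side_length B A.
Proof. by rewrite /side_length minkowskiC. Qed.

Definition det3 (R : realType) (A B C : 'rV[R]_3) : R :=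
  A 0 0 * (B 0 1 * C 0 2 - B 0 2 * C 0 1)
  - A 0 1 * (B 0 0 * C 0 2 - B 0 2 * C 0 0)
  + A 0 2 * (B 0 0 * C 0 1 - B 0 1 * C 0 0).

(** A nonzero row vector killed by the matrix with rows [A], [B], [C] is a nontrivial linear
    relation between them. *)
Lemma free_det3_neq0 (R : realType) (A B C : 'rV[R]_3) :
  free [:: A; B; C] -> det3 A B C != 0.
Proof.
move=> fr; pose X := [tuple A; B; C].
pose M : 'M[R]_3 := \matrix_(i, j) X`_i 0 j.
have <- : \det M = det3 A B C.
  rewrite (expand_det_row _ 0) !big_ord_recl big_ord0 /cofactor.
  rewrite !(expand_det_row _ 0) !big_ord_recl !big_ord0 /cofactor !det_mx11 !mxE /=.
  (* Indexing entries by naturals lets [ring] identify the same coordinate reached through different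
     ordinals. *)
  have [f fE] : exists f, forall (u : 'rV[R]_3) i, u 0 i = f u (val i).
    by exists (fun u k => u 0 (inord k)) => u i; rewrite inord_val.
  by rewrite /det3 !fE /= /bump /=; ring.
apply/negP => /det0P [v vN0 vM0].
have /freeP /(_ (v 0)) : free X by [].
move=> h; case/eqP: vN0; apply/rowP => i; rewrite mxE; apply: h.
apply/rowP => j; rewrite summxE; move/rowP: vM0 => /(_ j); rewrite !mxE => vM0.
by rewrite -[RHS]vM0; apply: eq_bigr => k _; rewrite !mxE.
Qed.

(** The Gram matrix is M J M^T, where M has rows [A], [B], [C] and J = diag(-1, 1, 1) has
    determinant -1. *)
Lemma gram3_det (R : realType) (A B C : 'rV[R]_3) :
  deSitter A -> deSitter B -> deSitter C ->
  let p := minkowski B C in let q := minkowski A C in let r := minkowski A B in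
  1 + 2 * p * q * r - p ^+ 2 - q ^+ 2 - r ^+ 2 = - det3 A B C ^+ 2.
Proof.
move=> hA hB hC p q r.
(* Writing each 1 as the square of a vertex makes the claim a polynomial identity in the
   coordinates. *)
have -> : 1 + 2 * p * q * r - p ^+ 2 - q ^+ 2 - r ^+ 2 =
  minkowski A A * minkowski B B * minkowski C C + 2 * p * q * r
  - minkowski A A * p ^+ 2 - minkowski B B * q ^+ 2 - minkowski C C * r ^+ 2.
  by rewrite hA hB hC; ring.
by rewrite /p /q /r /minkowski /det3; ring.
Qed.

(* The Gram determinant of four vectors of a three-dimensional space vanishes;
   this is its expansion along the row of [N]. *)
Lemma gram4_det (R : realType) (A B C N : 'rV[R]_3) :
  deSitter A -> deSitter B -> deSitter C ->
  let p := minkowski B C in let q := minkowski A C in let r := minkowski A B in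
  let x := minkowski N A in let y := minkowski N B in let z := minkowski N C in
  - det3 A B C ^+ 2 * minkowski N N =
  (1 - p ^+ 2) * x ^+ 2 + (1 - q ^+ 2) * y ^+ 2 + (1 - r ^+ 2) * z ^+ 2
  + 2 * ((q * r - p) * (y * z) + (p * r - q) * (x * z) + (p * q - r) * (x * y)).
Proof.
move=> hA hB hC p q r x y z.
transitivity (
  (minkowski B B * minkowski C C - p ^+ 2) * x ^+ 2
  + (minkowski A A * minkowski C C - q ^+ 2) * y ^+ 2
  + (minkowski A A * minkowski B B - r ^+ 2) * z ^+ 2
  + 2 * ((q * r - p * minkowski A A) * (y * z)
         + (p * r - q * minkowski B B) * (x * z)
         + (p * q - r * minkowski C C) * (x * y))).
  by rewrite /p /q /r /x /y /z /minkowski /det3; ring.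
by rewrite hA hB hC; ring.
Qed.

(** The component [B - r *: A] of [B] orthogonal to [A] has square 1 - r^2, which is positive unless
    this component vanishes; then [B] would be [A] or [- A]. *)
Lemma spacelike_side_sqr_lt1 (R : realType) (A B : 'rV[R]_3) :
  deSitter A -> deSitter B -> spacelike_side A B -> minkowski A B ^+ 2 < 1.
Proof.
move=> hA hB [AB ANB [_ pos]].
set r := minkowski A B.
have uS : B - r *: A \in <<[:: A; B]>>%VS.
  by rewrite rpredB ?rpredZ ?memv_span ?inE ?eqxx ?orbT.
have uu : minkowski (B - r *: A) (B - r *: A) = 1 - r ^+ 2.
  transitivity (minkowski B B - 2 * r * minkowski A B + r ^+ 2 * minkowski A A).
    by rewrite /minkowski !mxE; ring.
  by rewrite hA hB -/r; ring.
have [/eqP|u0] := eqVneq (B - r *: A) 0; last first.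
  by have := pos _ uS u0; rewrite uu subr_gt0.
rewrite subr_eq0 => /eqP eB.
have : r ^+ 2 == 1.
  have -> : r ^+ 2 = r ^+ 2 * minkowski A A by rewrite hA mulr1.
  by rewrite -[X in _ == X]hB {1 2}eB /minkowski !mxE; apply/eqP; ring.
rewrite sqrf_eq1 => /orP [] /eqP r1; move: AB ANB.
  by rewrite {1}eB r1 scale1r eqxx.
by rewrite eB r1 scaleN1r opprK eqxx.
Qed.

Lemma contractible_minkowski (R : realType) (D : {fset 'rV[R]_3}) :
  contractible D ->
  exists2 N : 'rV[R]_3,
    0 < minkowski N N & forall A, A \in D -> 0 < minkowski N A.
Proof.
case=> n n0 nD; exists (\row_(j < 3) [:: 0; n 0 0; n 0 1]`_j) => [|A /nD].
  rewrite /minkowski !mxE /= mul0r oppr0 add0r -!expr2.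
  rewrite lt0r addr_ge0 ?sqr_ge0 // andbT paddr_eq0 ?sqr_ge0 // !sqrf_eq0.
  apply: contra n0 => /andP [/eqP n00 /eqP n01]; apply/eqP/rowP => i.
  rewrite mxE; case: (unliftP ord0 i) => [j ->|-> //].
  by rewrite ord1 -n01; congr (n _ _); apply/val_inj.
rewrite big_ord_recl big_ord1 /minkowski !mxE /= mul0r oppr0 add0r.
congr (_ < _ * A _ _ + n _ _ * A _ _); exact/val_inj.
Qed.

Lemma acos_lt_dist (R : realType) (p q r : R) :
  p ^+ 2 < 1 -> q ^+ 2 < 1 -> r ^+ 2 < 1 ->
  1 + 2 * p * q * r - p ^+ 2 - q ^+ 2 - r ^+ 2 < 0 -> q * r <= p ->
  acos p < `|acos q - acos r|.
Proof.
have itv (t : R) : t ^+ 2 < 1 -> -1 <= t <= 1.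
  by move=> t1; apply/andP; split; nra.
move=> p1 q1 r1 G0 qrp.
have [/itv hp /itv hq /itv hr] := And3 p1 q1 r1.
(* The difference of the two sides is exactly the Gram determinant. *)
have lt : (1 - q ^+ 2) * (1 - r ^+ 2) < (p - q * r) ^+ 2.
  by rewrite -subr_lt0 (le_lt_trans _ G0) //; lra.
(* Since [p - q * r] is nonnegative, taking square roots in [lt] bounds the product of the sines by
   it. *)
have cosd : cos `|acos q - acos r| < p.
  rewrite cos_norm cosB !acosK ?in_itv // !sin_acos // -sqrtrM ?subr_ge0 ?ltW //.
  rewrite -ltrBrDl -[ltRHS]ger0_norm ?subr_ge0 // -sqrtr_sqr ltr_sqrt //.
  by apply: le_lt_trans lt; rewrite mulr_ge0 ?subr_ge0 ?ltW.
have [q0 qpi] := (acos_ge0 hq, acos_lepi hq).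
have [r0 rpi] := (acos_ge0 hr, acos_lepi hr).
(* Cosine is strictly decreasing on [0, pi], where both angles lie. *)
rewrite -(ltr_cos (R := R)) ?in_itv /= ?acosK ?in_itv //.
- by rewrite acos_ge0 ?acos_lepi.
- by rewrite normr_ge0 ler_norml; apply/andP; split; lra.
Qed.

(** If all three inequalities failed, every term on the right of [gram4_det] would be positive,
    while its left side is at most 0. *)
Lemma minkowski_mul_le (R : realType) (A B C N : 'rV[R]_3) :
  deSitter A -> deSitter B -> deSitter C ->
  0 < minkowski N N ->
  0 < minkowski N A -> 0 < minkowski N B -> 0 < minkowski N C ->
  let p := minkowski B C in let q := minkowski A C in let r := minkowski A B in
  p ^+ 2 < 1 -> q ^+ 2 < 1 -> r ^+ 2 < 1 ->
  [\/ q * r <= p, p * r <= q | p * q <= r].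
Proof.
move=> hA hB hC NN NA NB NC p q r p1 q1 r1.
have [?|hp] := leP (q * r) p; first exact: Or31.
have [?|hq] := leP (p * r) q; first exact: Or32.
have [?|hr] := leP (p * q) r; first exact: Or33.
have : - det3 A B C ^+ 2 * minkowski N N <= 0.
  by rewrite mulNr oppr_le0 mulr_ge0 ?sqr_ge0 ?ltW.
rewrite gram4_det // leNgt => /negP [].
by do ![by [] | by rewrite subr_gt0 | exact: exprn_gt0 | exact: ltr0n
       | apply: addr_gt0 | apply: mulr_gt0].
Qed.

Lemma no_triangle_inequality (R : realType) (A B C N : 'rV[R]_3) :
  deSitter A -> deSitter B -> deSitter C ->
  spacelike_side B C -> spacelike_side A C -> spacelike_side A B ->
  det3 A B C != 0 -> 0 < minkowski N N ->
  0 < minkowski N A -> 0 < minkowski N B -> 0 < minkowski N C ->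
  let a := side_length B C in let b := side_length A C in
  let c := side_length A B in
  [\/ b + c < a, a + c < b | a + b < c].
Proof.
move=> hA hB hC sBC sAC sAB d0 NN NA NB NC a b c.
have p1 := spacelike_side_sqr_lt1 hB hC sBC.
have q1 := spacelike_side_sqr_lt1 hA hC sAC.
have r1 := spacelike_side_sqr_lt1 hA hB sAB.
have G0 : - det3 A B C ^+ 2 < 0 by rewrite oppr_lt0 exprn_even_gt0.
move: (minkowski_mul_le hA hB hC NN NA NB NC p1 q1 r1) G0.
rewrite -gram3_det //; set p := minkowski B C; set q := minkowski A C.
set r := minkowski A B => cases G0; case: cases => le.
- have := acos_lt_dist p1 q1 r1 G0 le.
  by rewrite ltr_normr => /orP [] h; [apply: Or32|apply: Or33];
    rewrite /a /b /c /side_length; lra.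
(* The Gram determinant is symmetric in [p], [q], [r], so the same bound applies after a
   permutation. *)
- have : acos q < `|acos p - acos r| by apply: acos_lt_dist => //; lra.
  by rewrite ltr_normr => /orP [] h; [apply: Or31|apply: Or33];
    rewrite /a /b /c /side_length; lra.
- have : acos r < `|acos p - acos q| by apply: acos_lt_dist => //; lra.
  by rewrite ltr_normr => /orP [] h; [apply: Or31|apply: Or32];
    rewrite /a /b /c /side_length; lra.
Qed.

Theorem corollary5p16 (R : realType) (D : {fset 'rV[R]_3}) :
  spatiolateral D -> nondegenerate_triangle D -> contractible D ->
  exists A B C : 'rV[R]_3,
    D = [fset A; B; C]%fset /\
    side_length A C + side_length A B < side_length B C.
Proof.
move=> [D3 hdS hside] fD /contractible_minkowski [N NN ND].
have [A [B [C eD]]] : exists A B C, D = [:: A; B; C] :> seq _.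
  by case: (D : seq _) D3 => [|A [|B [|C []]]] // _; exists A, B, C.
have mD x : (x \in D) = [|| x == A, x == B | x == C].
  by rewrite -[x \in D]/(x \in (D : seq _)) eD !inE.
have [AD BD CD] : [/\ A \in D, B \in D & C \in D].
  by rewrite !mD !eqxx !orbT.
have := fset_uniq D; rewrite eD /= !inE negb_or andbT => /andP [/andP [AB AC] BC].
have d0 : det3 A B C != 0 by apply: free_det3_neq0; rewrite -eD.
case: (no_triangle_inequality (hdS _ AD) (hdS _ BD) (hdS _ CD)
  (hside _ _ BD CD BC) (hside _ _ AD CD AC) (hside _ _ AD BD AB) d0 NN
  (ND _ AD) (ND _ BD) (ND _ CD)) => lt.
(* In each case the vertex opposite the longest side is named first. *)
- exists A, B, C; split=> //.
  by apply/fsetP => x; rewrite mD !inE orbA.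
- exists B, A, C; split; last by rewrite (side_lengthC B A).
  by apply/fsetP => x; rewrite mD !inE orbCA orbA.
- exists C, A, B; split; last first.
    by rewrite (side_lengthC C B) (side_lengthC C A).
  by apply/fsetP => x; rewrite mD !inE orbA orbC orbA.
Qed.
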